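(* Suppose that $\gamma$ and $\gamma'$ are fully mutated mutation sequences (with the same number $n$ of variables). Then $\mu_\gamma(y)=\mu_{\gamma'}(y)$ implies $\tau_\gamma(y)=\tau_{\gamma'}(y)$.
   Context: Fix a positive integer $n$. Write $[x]_+=\max(0,x)$. An $n\times n$ integer matrix $B$ is skew-symmetrizable if there are positive integers $d_1,\dots,d_n$ with $d_iB_{ij}=-d_jB_{ji}$. Let $\mathcal F_{\mathrm{sf}}$ be the set of rational functions $f/g$ in $y_1,\dots,y_n$ with $f,g\in\mathbb Q[y_1,\dots,y_n]$ nonzero polynomials with non-negative coefficients. A Y-seed is a pair $(B,Y)$ with $B$ an $n\times n$ skew-symmetrizable integer matrix and $Y=(Y_1,\dots,Y_n)\in\mathcal F_{\mathrm{sf}}^n$. For $k\in\{1,\dots,n\}$ the Y-seed mutation is $\mu_k(B,Y)=(\widetilde B,\widetilde Y)$ where: $\widetilde B_{ij}=-B_{ij}$ if $i=k$ or $j=k$; otherwise $\widetilde B_{ij}=B_{ij}+B_{ik}B_{kj}$ if $B_{ik}>0$ and $B_{kj}>0$, $\widetilde B_{ij}=B_{ij}-B_{ik}B_{kj}$ if $B_{ik}<0$ and $B_{kj}<0$, and $\widetilde B_{ij}=B_{ij}$ in the remaining cases; and $\widetilde Y_k=Y_k^{-1}$, while for $i\neq k$, $\widetilde Y_i=Y_i(Y_k^{-1}+1)^{-B_{ki}}$ if $B_{ki}\ge 0$ and $\widetilde Y_i=Y_i(Y_k+1)^{-B_{ki}}$ if $B_{ki}\le 0$. A permutation $\sigma$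 of $\{1,\dots,n\}$ acts by $\sigma(B,Y)=(\sigma(B),\sigma(Y))$, $\sigma(B)_{ij}=B_{\sigma^{-1}(i)\sigma^{-1}(j)}$, $\sigma(Y)_i=Y_{\sigma^{-1}(i)}$. A mutation sequence (of length $T\ge 1$) is a triple $\gamma=(B,m,\sigma)$ with $B$ an $n\times n$ skew-symmetrizable integer matrix, $m=(m_1,\dots,m_T)$ a sequence in $\{1,\dots,n\}$ and $\sigma=(\sigma_1,\dots,\sigma_T)$ a sequence of permutations of $\{1,\dots,n\}$. Put $(B(0),Y(0))=(B,(y_1,\dots,y_n))$ and $(B(t),Y(t))=\sigma_t(\mu_{m_t}(B(t-1),Y(t-1)))$ for $t=1,\dots,T$. The cluster transformation of $\gamma$ is the vector-valued rational function $\mu_\gamma(y)=Y(T)$. (The matrices $B$ and lengths $T$ of $\gamma$ and $\gamma'$ may differ.) Mutation network. Let $\overline{\mathcal E}=\{(i,t)\mid 1\le i\le n,\ 0\le t\le T\}$ and let $\sim$ be the equivalence relation on $\overline{\mathcal E}$ generated by $(i,t-1)\sim(\sigma_t(i),t)$ for $1\le t\le T$ and $i\ne m_t$, and $(i,T)\sim(i,0)$ for all $i$. Put $\mathcal E=\overline{\mathcal E}/\sim$. The mutation network $\mathcal N_\gamma$ is the graph with black vertices labeled by $\mathcal E$, square vertices labeled by $1,\dots,T$, and for each $t$ the following edges (all kept with multiplicity, without cancelling opposite arrows): one broken edge between $t$ and $[(m_t,t-1)]$ and one broken edge between $t$ and $[(\sigma_t(m_t),t)]$; and, for each $i$, $[B_{m_t,i}(t-1)]_+$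 arrows from $t$ to $[(i,t-1)]$ and $[-B_{m_t,i}(t-1)]_+$ arrows from $[(i,t-1)]$ to $t$. For $e\in\mathcal E$ and $1\le t\le T$ let $n^0_{et}$ be the number of broken edges between $e$ and $t$, $n^+_{et}$ the number of arrows from $t$ to $e$, $n^-_{et}$ the number of arrows from $e$ to $t$; let $N_0,N_+,N_-$ be the corresponding $\mathcal E\times T$ matrices. The Neumann-Zagier matrices are $A_+=N_0-N_+$ and $A_-=N_0-N_-$. $\gamma$ is fully mutated if for every $e\in\mathcal E$ there is $t\in\{1,\dots,T\}$ with $(m_t,t-1)\in e$. In that case $t\mapsto[(m_t,t-1)]$ is a bijection $\{1,\dots,T\}\to\mathcal E$, and $\mathcal E\times T$ matrices such as $A_\pm$ are regarded as $T\times T$ matrices through it. For $1\le t\le T$ let $z_{t,+}=\frac{Y_{m_t}(t-1)}{Y_{m_t}(t-1)+1}$ and $z_{t,-}=\frac{1}{Y_{m_t}(t-1)+1}$, and let $Z_\pm(y)=\mathrm{diag}(z_{1,\pm},\dots,z_{T,\pm})$. For a fully mutated mutation sequence $\gamma$, define the rational function $\tau_\gamma(y)=\det\bigl(A_+Z_-(y)+A_-Z_+(y)\bigr)$. *)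

(* Defs.v *)
From HB Require Import structures.
From mathcomp Require Import all_boot all_order all_fingroup all_algebra.
From mathcomp Require Import mpoly.

Set Implicit Arguments.
Unset Strict Implicit.
Unset Printing Implicit Defensive.

Import Order.TTheory GRing.Theory Num.Theory.
Local Open Scope ring_scope.

Definition pos_part (x : int) : int := Num.max 0 x.

Definition skew_symmetrizable (n : nat) (B : 'M[int]_n) : Prop :=
  exists d : 'I_n -> int,
    (forall i, 0 < d i) /\ (forall i j, d i * B i j = - (d j * B j i)).

Notation ratfun n := {fraction {mpoly rat[n]}}.

Definition nonneg_coeffs (n : nat) (p : {mpoly rat[n]}) : Prop :=
  forall m : 'X_{1..n}, 0 <= p@_m.

(* Membership in F_sf. *)
Definition subtraction_free (n : nat) (x : ratfun n) : Prop :=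
  exists f g : {mpoly rat[n]},
    [/\ f != 0, g != 0, nonneg_coeffs f, nonneg_coeffs g &
        x = (tofrac f) / (tofrac g)].

(* Raw data of a Y-seed; [is_yseed] singles out the actual Y-seeds, and
   [is_yseed_seed_at] shows that only those occur below, so that the total
   inverse of the field is never applied to 0. *)
Definition seed (n : nat) : Type := ('M[int]_n * {ffun 'I_n -> ratfun n})%type.

Definition is_yseed (n : nat) (s : seed n) : Prop :=
  skew_symmetrizable s.1 /\ forall i, subtraction_free (s.2 i).

Definition mutate_matrix (n : nat) (k : 'I_n) (B : 'M[int]_n) : 'M[int]_n :=
  \matrix_(i, j)
    if (i == k) || (j == k) then - B i j
    else if (0 < B i k) && (0 < B k j) then B i j + B i k * B k j
    else if (B i k < 0) && (B k j < 0) then B i j - B i k * B k j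
    else B i j.

Definition mutate_vars (n : nat) (k : 'I_n) (B : 'M[int]_n)
    (Y : {ffun 'I_n -> ratfun n}) : {ffun 'I_n -> ratfun n} :=
  [ffun i => if i == k then (Y k)^-1
             else if 0 <= B k i then Y i * ((Y k)^-1 + 1) ^ (- B k i)
             else Y i * (Y k + 1) ^ (- B k i)].

Definition mutate (n : nat) (k : 'I_n) (s : seed n) : seed n :=
  (mutate_matrix k s.1, mutate_vars k s.1 s.2).

Definition permute (n : nat) (p : 'S_n) (s : seed n) : seed n :=
  (\matrix_(i, j) s.1 ((p^-1)%g i) ((p^-1)%g j), [ffun i => s.2 ((p^-1)%g i)]).

Record mutation_sequence (n : nat) : Type := MutationSequence {
  ms_len : nat;
  ms_len_gt0 : (0 < ms_len)%N;
  ms_matrix : 'M[int]_n;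
  ms_skew : skew_symmetrizable ms_matrix;
  ms_index : ms_len.-tuple 'I_n;
  ms_perm : ms_len.-tuple 'S_n
}.

Section MutationSequence.

Variables (n : nat) (g : mutation_sequence n).

Local Notation T := (ms_len g).
Local Notation m := (tnth (ms_index g)).
Local Notation sg := (tnth (ms_perm g)).

Definition initial_seed : seed n :=
  (ms_matrix g, [ffun i => tofrac ('X_i : {mpoly rat[n]})]).

(* (B(t), Y(t)). Steps are indexed by 'I_T, i.e. from 0: step t leads from
   time t to time t.+1, and is the (t+1)-st step in 1-based numbering.
   For t > T, which is never used, the seed stays constant. *)
Fixpoint seed_at (t : nat) : seed n :=
  if t is t'.+1 then
    if (insub t' : option 'I_T) is Some u
    then permute (sg u) (mutate (m u) (seed_at t'))
    else seed_at t'
  else initial_seed.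

Definition B_at (t : nat) : 'M[int]_n := (seed_at t).1.
Definition Y_at (t : nat) : {ffun 'I_n -> ratfun n} := (seed_at t).2.

Definition cluster_transformation : {ffun 'I_n -> ratfun n} := Y_at T.

Definition node : finType := ('I_n * 'I_T.+1)%type.

Definition before (t : 'I_T) : 'I_T.+1 := widen_ord (leqnSn T) t.
Definition after (t : 'I_T) : 'I_T.+1 := lift ord0 t.

Definition glue : rel node := fun p q =>
  [exists t : 'I_T,
     [&& p.2 == before t, p.1 != m t & q == (sg t p.1, after t)]]
  || [&& p.2 == ord_max, q.2 == ord0 & p.1 == q.1].

Definition node_class (p : node) : {set node} :=
  [set q | connect [rel x y | glue x y || glue y x] p q].

Definition black_vertices : {set {set node}} := [set node_class p | p : node].

(* n0_{e,t}, n+_{e,t} and n-_{e,t}: the edges at t whose other end is e are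
   counted with multiplicity, as distinct nodes may have the same class. *)
Definition broken_edges (e : {set node}) (t : 'I_T) : int :=
  (node_class (m t, before t) == e)%:R
  + (node_class (sg t (m t), after t) == e)%:R.

Definition arrows_to (e : {set node}) (t : 'I_T) : int :=
  \sum_(i < n | node_class (i, before t) == e) pos_part (B_at t (m t) i).

Definition arrows_from (e : {set node}) (t : 'I_T) : int :=
  \sum_(i < n | node_class (i, before t) == e) pos_part (- B_at t (m t) i).

Definition NZ_plus (e : {set node}) (t : 'I_T) : int :=
  broken_edges e t - arrows_to e t.

Definition NZ_minus (e : {set node}) (t : 'I_T) : int :=
  broken_edges e t - arrows_from e t.

Definition fully_mutated : Prop :=
  forall e, e \in black_vertices -> exists t : 'I_T, (m t, before t) \in e.

(* A_+ and A_- as T x T matrices, with rows reindexed along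
   t |-> [(m_t, t-1)]; this is meaningful for fully mutated sequences. *)
Definition step_class (t : 'I_T) : {set node} := node_class (m t, before t).

Definition A_plus : 'M[int]_T := \matrix_(s, t) NZ_plus (step_class s) t.
Definition A_minus : 'M[int]_T := \matrix_(s, t) NZ_minus (step_class s) t.

Definition z_plus (t : 'I_T) : ratfun n := Y_at t (m t) / (Y_at t (m t) + 1).
Definition z_minus (t : 'I_T) : ratfun n := 1 / (Y_at t (m t) + 1).

Definition Z_plus : 'M[ratfun n]_T := diag_mx (\row_t z_plus t).
Definition Z_minus : 'M[ratfun n]_T := diag_mx (\row_t z_minus t).

Definition tau : ratfun n :=
  \det (map_mx intr A_plus *m Z_minus + map_mx intr A_minus *m Z_plus).

End MutationSequence.

Section YSeeds.

Variable n : nat.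
Implicit Types (x y : ratfun n) (p q : {mpoly rat[n]}) (s : seed n).

Lemma nonneg_coeffsD p q :
  nonneg_coeffs p -> nonneg_coeffs q -> nonneg_coeffs (p + q).
Proof. by move=> hp hq k; rewrite mcoeffD addr_ge0. Qed.

Lemma nonneg_coeffsM p q :
  nonneg_coeffs p -> nonneg_coeffs q -> nonneg_coeffs (p * q).
Proof. by move=> hp hq k; rewrite mcoeffM sumr_ge0 // => i _; rewrite mulr_ge0. Qed.

Lemma nonneg_coeffsD_neq0 p q :
  nonneg_coeffs p -> nonneg_coeffs q -> p != 0 -> p + q != 0.
Proof.
move=> hp hq; apply: contra => /eqP pq0; apply/eqP/mpolyP => k.
have := congr1 (mcoeff k) pq0; rewrite mcoeffD mcoeff0 => /eqP.
by rewrite paddr_eq0 // => /andP[/eqP-> _].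
Qed.

Lemma subtraction_free_tofrac p :
  p != 0 -> nonneg_coeffs p -> subtraction_free (tofrac p).
Proof.
move=> p0 hp; exists p, 1; split; rewrite ?oner_eq0 //.
  by move=> k; rewrite mcoeff1 ler0n.
by rewrite tofrac1 divr1.
Qed.

Lemma subtraction_free1 : subtraction_free (1 : ratfun n).
Proof.
rewrite -tofrac1; apply: subtraction_free_tofrac; rewrite ?oner_eq0 //.
by move=> k; rewrite mcoeff1 ler0n.
Qed.

Lemma subtraction_freeD x y :
  subtraction_free x -> subtraction_free y -> subtraction_free (x + y).
Proof.
move=> [f [g [f0 g0 hf hg ->]]] [f' [g' [f0' g0' hf' hg' ->]]].
exists (f * g' + f' * g), (g * g'); split.
- by apply: nonneg_coeffsD_neq0; rewrite ?mulf_neq0 //; apply: nonneg_coeffsM.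
- by rewrite mulf_neq0.
- by apply: nonneg_coeffsD; apply: nonneg_coeffsM.
- exact: nonneg_coeffsM.
- by rewrite tofracD !tofracM addf_div ?tofrac_eq0.
Qed.

Lemma subtraction_freeM x y :
  subtraction_free x -> subtraction_free y -> subtraction_free (x * y).
Proof.
move=> [f [g [f0 g0 hf hg ->]]] [f' [g' [f0' g0' hf' hg' ->]]].
exists (f * f'), (g * g'); split; rewrite ?mulf_neq0 //;
  try exact: nonneg_coeffsM.
by rewrite !tofracM mulf_div.
Qed.

Lemma subtraction_freeV x : subtraction_free x -> subtraction_free x^-1.
Proof.
move=> [f [g [f0 g0 hf hg ->]]]; exists g, f; split=> //.
by rewrite invf_div.
Qed.

Lemma subtraction_freeX x (z : int) :
  subtraction_free x -> subtraction_free (x ^ z).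
Proof.
move=> hx.
have hX k : subtraction_free (x ^+ k).
  elim: k => [|k IHk]; first exact: subtraction_free1.
  by rewrite exprS; apply: subtraction_freeM.
by case: z => k; [apply: hX | rewrite NegzE; apply/subtraction_freeV/hX].
Qed.

Lemma subtraction_free_neq0 x : subtraction_free x -> x != 0.
Proof.
by move=> [f [g [f0 g0 _ _ ->]]]; rewrite mulf_neq0 ?invr_eq0 ?tofrac_eq0.
Qed.

Lemma skew_symmetrizable_mutate (k : 'I_n) (B : 'M[int]_n) :
  skew_symmetrizable B -> skew_symmetrizable (mutate_matrix k B).
Proof.
move=> [d [d_gt0 dB]]; exists d; split=> // i j; rewrite !mxE orbC.
have posE a b : (0 < B a b) = (B b a < 0).
  by rewrite -(pmulr_rgt0 _ (d_gt0 a)) dB oppr_gt0 pmulr_rlt0.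
have prodE : d i * (B i k * B k j) = d j * (B j k * B k i).
  rewrite [LHS]mulrA (dB i k) mulNr mulrAC (dB k j) mulNr opprK.
  by rewrite -mulrA.
case: ifP => _; first by rewrite !mulrN dB.
rewrite (posE i k) (posE k j) -(posE k i) -(posE j k) andbC.
rewrite [(0 < B j k) && _]andbC [(B j k < 0) && _]andbC.
case: (ltgtP (B k i) 0) => _ /=; case: (ltgtP (B j k) 0) => _ //=;
  by rewrite ?mulrDr ?mulrN ?opprD ?opprK dB ?prodE.
Qed.

Lemma is_yseed_mutate (k : 'I_n) s : is_yseed s -> is_yseed (mutate k s).
Proof.
move=> [hB hY]; split=> [|i]; first exact: skew_symmetrizable_mutate.
rewrite ffunE; case: eqP => _; first exact: subtraction_freeV.
have h1 := subtraction_free1.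
case: ifP => _; apply: subtraction_freeM => //; apply: subtraction_freeX;
  by apply: subtraction_freeD => //; apply: subtraction_freeV.
Qed.

Lemma is_yseed_permute (p : 'S_n) s : is_yseed s -> is_yseed (permute p s).
Proof.
move=> [[d [d_gt0 dB]] hY]; split=> [|i]; last by rewrite ffunE.
by exists (fun i => d ((p^-1)%g i)); split=> // i j; rewrite !mxE.
Qed.

Lemma is_yseed_seed_at (g : mutation_sequence n) (t : nat) :
  is_yseed (seed_at g t).
Proof.
elim: t => [|t IHt] /=.
  split=> [|i]; first exact: ms_skew.
  rewrite ffunE; apply: subtraction_free_tofrac => [|k].
    by apply/eqP => /(congr1 (mcoeff U_(i)%MM)); rewrite mcoeffX eqxx mcoeff0.
  by rewrite mcoeffX ler0n.
by case: insubP => [u _ _|_] //; apply/is_yseed_permute/is_yseed_mutate.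
Qed.

End YSeeds.

(* Main.v *)
Require Import Defs.
From mathcomp Require Import all_boot all_order all_fingroup all_algebra.
From mathcomp Require Import mpoly.
From mathcomp Require Import generic_quotient ring.

(* The determinant [tau g] equals [det (1 - L)], where
   [L i j = y_j (d Y_i(T) / d y_j) / Y_i(T)] is the logarithmic Jacobian of the
   cluster transformation, so it depends on that transformation only.

   The logarithmic derivatives x_(i,t) of the Y_i(t) satisfy linear equations
   which express x at time t through x at time t - 1. Close this system up by
   identifying time T with time 0, and let M be the square matrix of the closed
   system, indexed by all pairs (i, t). Eliminating the unknowns along time
   gives det M = det (1 - L). Eliminating instead along the chains of nodes
   glued together in the network leaves one unknown and one equation per class;
   the coefficients of this reduced system are those of A_+ Z_- + A_- Z_+, as
   [z_+ + z_- = 1]. Both eliminations are unitriangular: the first one for the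
   order given by time, the second one for the number of steps to the next
   mutation of the node, which is finite as [g] is fully mutated. *)

Set Implicit Arguments.
Unset Strict Implicit.
Unset Printing Implicit Defensive.

Import Order.TTheory GRing.Theory Num.Theory.
Local Open Scope ring_scope.
Local Open Scope quotient_scope.

(** * Determinants of perturbed unitriangular matrices *)

(** Sylvester's identity: both sides are the determinant of one block matrix, cleared by a block
    unitriangular factor on the right or on the left. *)
Lemma det1_sub_mulmxC (R : comNzRingType) (m n : nat)
    (A : 'M[R]_(m, n)) (B : 'M[R]_(n, m)) :
  \det (1%:M - A *m B) = \det (1%:M - B *m A).
Proof.
have -> : \det (1%:M - A *m B) = \det (block_mx 1%:M A B 1%:M).
  transitivity (\det (block_mx 1%:M A B 1%:M *m block_mx 1%:M 0 (- B) 1%:M)).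
    rewrite mulmx_block !mul1mx !mulmx1 !mulmx0 !add0r mulmxN.
    by rewrite subrr det_ublock det1 mulr1.
  by rewrite det_mulmx det_lblock !det1 !mulr1.
transitivity (\det (block_mx 1%:M 0 (- B) 1%:M *m block_mx 1%:M A B 1%:M)).
  by rewrite det_mulmx det_lblock !det1 !mul1r.
rewrite mulmx_block !mul1mx !mulmx1 !mul0mx !addr0 addNr mulNmx addrC.
by rewrite det_ublock det1 mul1r.
Qed.

(* A permutation contributing to the Leibniz expansion does not decrease [h],
   hence preserves it, as the sum of the values of [h] is invariant. *)
Lemma det_graded_unitriangular (R : comNzRingType) (N : nat) (M : 'M[R]_N)
    (h : 'I_N -> nat) :
  (forall i, M i i = 1) ->
  (forall i j, i != j -> M i j != 0 -> (h i < h j)%N) -> \det M = 1.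
Proof.
move=> M1 Mh; rewrite /determinant (bigD1 1%g) //=.
rewrite [X in _ + X]big1 => [|s s_neq1].
  by rewrite odd_perm1 mul1r addr0 big1 // => i _; rewrite perm1.
case: (boolP [forall i, M i (s i) != 0]) => [/forallP Ms|]; last first.
  rewrite negb_forall => /existsP[i]; rewrite negbK => /eqP Mi0.
  by rewrite (bigD1 i) //= Mi0 mul0r mulr0.
case/eqP: s_neq1; apply/permP => i; rewrite perm1.
apply/eqP; apply: contraT => si.
have hs j : (h j <= h (s j))%N.
  by have [->//|sj] := eqVneq (s j) j; apply/ltnW/Mh => //; rewrite eq_sym.
have hlt: (h i < h (s i))%N by apply: Mh => //; rewrite eq_sym.
have : (\sum_j h j < \sum_j h (s j))%N.
  rewrite (bigD1 i) //= [X in (_ < X)%N](bigD1 i) //= -addSn.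
  by apply: leq_add => //; apply: leq_sum.
by rewrite (reindex_inj (@perm_inj _ s)) /= ltnn.
Qed.

Definition fun_mx (R : Type) (I : finType) (f : I -> I -> R) : 'M[R]_#|I| :=
  \matrix_(a, b) f (enum_val a) (enum_val b).

Lemma tr_fun_mx (R : Type) (I : finType) (f : I -> I -> R) :
  (fun_mx f)^T = fun_mx (fun p q => f q p).
Proof. by apply/matrixP => a b; rewrite !mxE. Qed.

(* [Q (1 - D) = E] yields the factorisation
   [1 - (D + K E) = (1 - K Q) (1 - D)], with [det (1 - D) = 1]. *)
Lemma det_graded_perturbation (R : comNzRingType) (I : finType) (k : nat)
    (D : I -> I -> R) (K : I -> 'I_k -> R) (E Q : 'I_k -> I -> R)
    (h : I -> nat) :
  (forall p q, D p q != 0 -> (h p < h q)%N) ->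
  (forall s q, E s q = Q s q - \sum_p Q s p * D p q) ->
  \det (fun_mx (fun p q => (p == q)%:R - (D p q + \sum_t K p t * E t q)))
  = \det (\matrix_(s, t) ((s == t)%:R - \sum_p Q s p * K p t)).
Proof.
move=> Dh QE.
pose Dm := fun_mx D; pose Km := \matrix_(a < #|I|, t < k) K (enum_val a) t.
pose Qm := \matrix_(s < k, a < #|I|) Q s (enum_val a).
have sumE (f : I -> R) : \sum_p f p = \sum_(a < #|I|) f (enum_val a).
  exact: (big_enum_val (A := I)).
have -> : fun_mx (fun p q => (p == q)%:R - (D p q + \sum_t K p t * E t q))
    = (1%:M - Km *m Qm) *m (1%:M - Dm).
  have QD : Qm *m (1%:M - Dm) = \matrix_(s < k, a < #|I|) E s (enum_val a).
    apply/matrixP => s a; rewrite mulmxBr mulmx1 !mxE QE sumE.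
    by under eq_bigr do rewrite !mxE.
  rewrite mulmxBl mul1mx -mulmxA QD; apply/matrixP => a b.
  rewrite !mxE (inj_eq enum_val_inj) opprD addrA.
  by under [in RHS]eq_bigr do rewrite !mxE.
rewrite det_mulmx (_ : \det (1%:M - Dm) = 1) ?mulr1.
  rewrite det1_sub_mulmxC; congr (\det _); apply/matrixP => s t.
  by rewrite !mxE sumE; under eq_bigr do rewrite !mxE.
have D0 p : D p p = 0.
  by apply/eqP; apply: contraT => /Dh; rewrite ltnn.
apply: (@det_graded_unitriangular _ _ _ (h \o enum_val)) => [a|a b ab].
  by rewrite !mxE eqxx D0 subr0.
by rewrite !mxE (negPf ab) sub0r oppr_eq0 => /Dh.
Qed.

(** * Extension of a derivation to the fraction field *)

Lemma quotient_rule_add (F : fieldType) (a b a' b' da db da' db' : F) :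
  b' != 0 -> b != 0 ->
  ((da * b' + a * db' + (da' * b + a' * db)) * (b * b')
    - (a * b' + a' * b) * (db * b' + b * db')) / (b * b') ^+ 2
  = (da * b - a * db) / b ^+ 2 + (da' * b' - a' * db') / b' ^+ 2.
Proof. by move=> b'0 b0; field; rewrite ?b0 ?b'0. Qed.

Lemma quotient_rule_mul (F : fieldType) (a b a' b' da db da' db' : F) :
  b' != 0 -> b != 0 ->
  ((da * a' + a * da') * (b * b') - a * a' * (db * b' + b * db'))
    / (b * b') ^+ 2
  = (da * b - a * db) / b ^+ 2 * (a' / b')
    + a / b * ((da' * b' - a' * db') / b' ^+ 2).
Proof. by move=> b'0 b0; field; rewrite ?b0 ?b'0. Qed.

Section FractionDerivation.

Variables (R : idomainType) (d : R -> R).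
Hypothesis dD : {morph d : x y / x + y}.
Hypothesis dM : forall x y, d (x * y) = d x * y + x * d y.

Local Notation "x %:F" := (@FracField.tofrac R x).
Implicit Types (x y : {fraction R}) (a b : R).

Lemma pi_ratioE (r : {ratio R}) :
  \pi_{fraction R} r = (\n_r)%:F / (\d_r)%:F.
Proof.
have d0 := denom_ratioP r.
apply: (@mulIf _ (\d_r)%:F); first by rewrite tofrac_eq0.
rewrite mulfVK ?tofrac_eq0 //; rewrite /FracField.tofrac; unlock.
(* Both sides are now classes of ratios, compared by cross multiplication. *)
rewrite -[LHS](FracField.pi_mul r (Ratio (\d_r) 1)); apply/eqmodP => /=.
rewrite FracField.equivfE /FracField.mulf !numden_Ratio ?mulf_neq0 ?oner_eq0 //.
by rewrite !mulr1 mulrC.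
Qed.

Lemma fraction_ex x : exists a b, b != 0 /\ x = a%:F / b%:F.
Proof.
exists (\n_(repr x)), (\d_(repr x)); split; first exact: denom_ratioP.
by rewrite -pi_ratioE reprK.
Qed.

(** The quotient rule on the chosen representative; [fraction_der_div] shows that every other
    representative gives the same value. *)
Definition fraction_der x : {fraction R} :=
  (d (\n_(repr x)) * \d_(repr x) - \n_(repr x) * d (\d_(repr x)))%:F
  / (\d_(repr x))%:F ^+ 2.

Lemma fraction_der_div a b : b != 0 ->
  fraction_der (a%:F / b%:F) = (d a * b - a * d b)%:F / b%:F ^+ 2.
Proof.
move=> b0; rewrite /fraction_der; set x := a%:F / b%:F.
have e0 := denom_ratioP (repr x).
have: x = (\n_(repr x))%:F / (\d_(repr x))%:F by rewrite -pi_ratioE reprK.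
move: (\n_ _) (\d_ _) e0 => c e e0 /eqP.
rewrite eqr_div ?tofrac_eq0 // -!tofracM tofrac_eq => /eqP aecb.
apply/eqP; rewrite eqr_div ?expf_neq0 ?tofrac_eq0 //.
rewrite -!tofracXn -!tofracM tofrac_eq.
(* Differentiating [a * e = c * b] expresses [d c * b] through the other derivatives; the terms in
   [d e] then cancel. *)
have := congr1 d aecb; rewrite !dM => dab.
have k1 : d c * b = d a * e + a * d e - c * d b by rewrite dab; ring.
apply/eqP.
transitivity (b * e * (d c * b) - c * b * (b * d e)); first by ring.
rewrite k1 -aecb.
transitivity (b * e * (d a * e) - (c * b) * e * d b); first by ring.
by rewrite -aecb; ring.
Qed.

Lemma der1 : d 1 = 0.
Proof.
have := dM 1 1; rewrite !mulr1 mul1r => /eqP.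
by rewrite -subr_eq0 opprD addNKr oppr_eq0 => /eqP.
Qed.

Lemma fraction_der_tofrac a : fraction_der a%:F = (d a)%:F.
Proof.
have := @fraction_der_div a 1 (oner_neq0 _).
by rewrite tofrac1 !divr1 der1 mulr0 subr0 mulr1 expr1n divr1.
Qed.

Lemma fraction_derD : {morph fraction_der : x y / x + y}.
Proof.
move=> x y; have [a [b [b0 ->]]] := fraction_ex x.
have [a' [b' [b0' ->]]] := fraction_ex y.
rewrite addf_div ?tofrac_eq0 // -!tofracM -tofracD.
rewrite !fraction_der_div ?mulf_neq0 // !dD !dM.
rewrite !(tofracN, tofracD, tofracM).
have: b%:F != 0 by rewrite tofrac_eq0.
have: b'%:F != 0 by rewrite tofrac_eq0.
exact: quotient_rule_add.
Qed.

Lemma fraction_derM x y :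
  fraction_der (x * y) = fraction_der x * y + x * fraction_der y.
Proof.
have [a [b [b0 ->]]] := fraction_ex x.
have [a' [b' [b0' ->]]] := fraction_ex y.
rewrite mulf_div -!tofracM.
rewrite !fraction_der_div ?mulf_neq0 // !dM.
rewrite !(tofracN, tofracD, tofracM).
have: b%:F != 0 by rewrite tofrac_eq0.
have: b'%:F != 0 by rewrite tofrac_eq0.
exact: quotient_rule_mul.
Qed.

End FractionDerivation.

(** * Logarithmic derivatives of the mutation rule *)

Section LogDerivative.

Variables (F : fieldType) (D : F -> F).
Hypothesis DD : {morph D : x y / x + y}.
Hypothesis DM : forall x y, D (x * y) = D x * y + x * D y.
Implicit Types x y : F.

Definition dlog x := D x / x.

Lemma dlogM x y : x != 0 -> y != 0 -> dlog (x * y) = dlog x + dlog y.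
Proof. by move=> x0 y0; rewrite /dlog DM; field; rewrite x0 y0. Qed.

Lemma dlog1 : dlog 1 = 0.
Proof. by rewrite /dlog (der1 DM) mul0r. Qed.

Lemma dlogV x : x != 0 -> dlog x^-1 = - dlog x.
Proof.
move=> x0; apply/eqP; rewrite -addr_eq0 -dlogM ?invr_eq0 //.
by rewrite mulVf // dlog1.
Qed.

Lemma dlogXz x (z : int) : x != 0 -> dlog (x ^ z) = z%:~R * dlog x.
Proof.
move=> x0.
have dX k : dlog (x ^+ k) = k%:R * dlog x.
  elim: k => [|k IHk]; first by rewrite expr0 dlog1 mul0r.
  by rewrite exprS dlogM ?expf_neq0 // IHk -natr1 addrC mulrDl mul1r.
case: z => k; first exact: dX.
by rewrite NegzE -[x ^ _]/(x ^- k.+1) dlogV ?expf_neq0 // dX mulrNz mulNr.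
Qed.

Lemma dlog_add1 y : y != 0 -> y + 1 != 0 -> dlog (y + 1) = y / (y + 1) * dlog y.
Proof.
by move=> y0 y1; rewrite /dlog DD (der1 DM) addr0; field; rewrite ?y0 ?y1.
Qed.

(** For [y] the mutated variable, the factor [1 / (y + 1)] is [z_minus]; the other sign of [b] gives
    [z_plus] below. The weights in [tau] arise here. *)
Lemma dlog_mutation_ge0 x y (b : int) : x != 0 -> y != 0 -> y + 1 != 0 ->
  dlog (x * (y^-1 + 1) ^ (- b)) = dlog x + b%:~R * (1 / (y + 1)) * dlog y.
Proof.
move=> x0 y0 y1.
have yE : y^-1 + 1 = (y + 1) / y by field.
have yV1 : y^-1 + 1 != 0 by rewrite yE mulf_neq0 ?invr_eq0.
rewrite dlogM ?expfz_neq0 // dlogXz // dlog_add1 ?invr_eq0 // dlogV //.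
by rewrite yE rmorphN /=; field; rewrite ?y0 ?y1.
Qed.

Lemma dlog_mutation_le0 x y (b : int) : x != 0 -> y != 0 -> y + 1 != 0 ->
  dlog (x * (y + 1) ^ (- b)) = dlog x + (- b)%:~R * (y / (y + 1)) * dlog y.
Proof.
move=> x0 y0 y1.
by rewrite dlogM ?expfz_neq0 // dlogXz // dlog_add1 // mulrA.
Qed.

End LogDerivative.

(** * The logarithmic Jacobian and its evolution in time *)

Section LogJacobian.

Variable n : nat.

(** The Euler operator: the factor ['X_j] makes the logarithmic Jacobian of the initial variables
    the identity. *)
Definition euler_der (j : 'I_n) (p : {mpoly rat[n]}) : {mpoly rat[n]} :=
  'X_j * p^`M(j).

Lemma euler_derD j : {morph euler_der j : p q / p + q}.
Proof. by move=> p q; rewrite /euler_der mderivD mulrDr. Qed.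

Lemma euler_derM j p q :
  euler_der j (p * q) = euler_der j p * q + p * euler_der j q.
Proof. by rewrite /euler_der mderivM mulrDr -mulrA (mulrCA p). Qed.

Definition log_der (j : 'I_n) : ratfun n -> ratfun n :=
  dlog (fraction_der (euler_der j)).

Definition log_jacobian (Y : {ffun 'I_n -> ratfun n}) : 'M[ratfun n]_n :=
  \matrix_(i, j) log_der j (Y i).

Variable g : mutation_sequence n.

Local Notation T := (ms_len g).
Local Notation m := (tnth (ms_index g)).
Local Notation sg := (tnth (ms_perm g)).

Lemma log_jacobian0 : log_jacobian (Y_at g 0) = 1%:M.
Proof.
apply/matrixP => i j; rewrite !mxE ffunE /log_der /dlog.
have X0 : tofrac ('X_i : {mpoly rat[n]}) != 0.
  rewrite tofrac_eq0; apply/eqP => /(congr1 (mcoeff U_(i)%MM)) /eqP.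
  by rewrite mcoeffX eqxx mcoeff0 oner_eq0.
rewrite fraction_der_tofrac; last exact: euler_derM.
rewrite /euler_der mderivX mnm1E.
case: (eqVneq i j) X0 => [-> X0|_ _]; last first.
  by rewrite scale0r mulr0 tofrac0 mul0r.
have -> : (U_(j) - U_(j))%MM = 0%MM :> 'X_{1..n}.
  by apply/mnmP => k; rewrite mnmBE subnn mnm0E.
have -> : 'X_j * (1 *: 'X_[0%MM]) = 'X_j :> {mpoly rat[n]}.
  by rewrite scale1r mpolyX0 mulr1.
by rewrite divff.
Qed.

Lemma Y_at_neq0 t i : Y_at g t i != 0.
Proof. exact: subtraction_free_neq0 (proj2 (is_yseed_seed_at g t) i). Qed.

Lemma Y_at_add1_neq0 t i : Y_at g t i + 1 != 0.
Proof.
apply/subtraction_free_neq0/subtraction_freeD; last exact: subtraction_free1.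
exact: (proj2 (is_yseed_seed_at g t) i).
Qed.

Lemma B_at_diag t i : B_at g t i i = 0.
Proof.
have [[d [d0 dB]] _] := is_yseed_seed_at g t.
have /eqP := dB i i; rewrite -addr_eq0 -mulr2n mulrn_eq0 /=.
by rewrite mulf_eq0 gt_eqF ?d0 // => /eqP.
Qed.

(** Covers both branches of the mutation rule, as at most one of the two positive parts is
    nonzero. *)
Definition arrow_weight (u : 'I_T) (i : 'I_n) : ratfun n :=
  (pos_part (B_at g u (m u) i))%:~R * z_minus u
  + (pos_part (- B_at g u (m u) i))%:~R * z_plus u.

Lemma arrow_weight_diag u : arrow_weight u (m u) = 0.
Proof.
by rewrite /arrow_weight B_at_diag oppr0 /pos_part maxxx !mul0r addr0.
Qed.

Lemma z_minusD_plus (u : 'I_T) : z_minus u + z_plus u = 1.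
Proof.
by rewrite /z_minus /z_plus -mulrDl [1 + _]addrC divff // Y_at_add1_neq0.
Qed.

(** Linearisation of one step in logarithmic coordinates; row [j] belongs to the variable that the
    permutation moves from [i] to [j]. *)
Definition step_mx (u : 'I_T) : 'M[ratfun n]_n :=
  \matrix_(j, k) (let i := ((sg u)^-1)%g j in
    if i == m u then - (k == m u)%:R
    else (k == i)%:R + arrow_weight u i * (k == m u)%:R).

Lemma Y_at_step (u : 'I_T) j :
  Y_at g u.+1 j
  = mutate_vars (m u) (B_at g u) (Y_at g u) (((sg u)^-1)%g j).
Proof. by rewrite /Y_at /= valK /= ffunE. Qed.

Lemma log_jacobian_step (u : 'I_T) :
  log_jacobian (Y_at g u.+1) = step_mx u *m log_jacobian (Y_at g u).
Proof.
apply/matrixP => j l; rewrite !mxE Y_at_step.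
have DD := fraction_derD (@euler_derD l) (@euler_derM l).
have DM := fraction_derM (@euler_derM l).
have delta k : \sum_i (i == k)%:R * log_der l (Y_at g u i)
    = log_der l (Y_at g u k).
  rewrite (bigD1 k) //= eqxx mul1r big1 ?addr0 // => i /negPf->.
  by rewrite mul0r.
under eq_bigr => k _ do rewrite !mxE /=.
set i := ((sg u)^-1)%g j; rewrite ffunE; case: (eqVneq i (m u)) => [_|im].
  rewrite /log_der dlogV ?Y_at_neq0 //.
  rewrite -[dlog _ _](delta (m u)) -sumrN.
  by apply: eq_bigr => k _; rewrite mulNr.
under eq_bigr => k _ do rewrite mulrDl -mulrA.
rewrite big_split /= -mulr_sumr !delta /arrow_weight /pos_part.
set b := B_at g u (m u) i.
have [b0|b0] := leP 0 b.
  rewrite /log_der dlog_mutation_ge0 ?Y_at_neq0 ?Y_at_add1_neq0 //.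
  by rewrite max_l ?oppr_le0 // mul0r addr0.
rewrite /log_der dlog_mutation_le0 ?Y_at_neq0 ?Y_at_add1_neq0 //.
by rewrite max_r ?oppr_ge0 ?ltW // mul0r add0r.
Qed.

End LogJacobian.

(** * Classes of nodes as chains ending at mutated nodes *)

Section MutationNetwork.

Variables (n : nat) (g : mutation_sequence n).

Local Notation T := (ms_len g).
Local Notation m := (tnth (ms_index g)).
Local Notation sg := (tnth (ms_perm g)).
Local Notation sym_glue := [rel x y | glue (g := g) x y || glue y x].
Implicit Types (p q r : node g) (u s t : 'I_T).

Definition mutated_node u : node g := (m u, before u).

Definition mutated p := [exists u, p == mutated_node u].

(** Unlike [glue], this flow also continues through mutated nodes, so it is total. Being injective,
    it permutes the nodes, and its orbits are cycles. *)
Definition next_node p : node g :=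
  if (insub (p.2 : nat) : option 'I_T) is Some u then (sg u p.1, after u)
  else (p.1, ord0).

Lemma before_inj : injective (@before n g).
Proof. by move=> s t /(congr1 val) /= /val_inj. Qed.

Lemma after_inj : injective (@after n g).
Proof. exact: lift_inj. Qed.

Lemma before_neq_max u : before u != ord_max.
Proof. by rewrite -val_eqE /= neq_ltn ltn_ord. Qed.

Lemma after_neq0 u : after u != ord0.
Proof. by rewrite -val_eqE. Qed.

Variant before_spec : 'I_T.+1 -> Type :=
  | BeforeMax : before_spec ord_max
  | BeforeStep u : before_spec (before u).

Lemma beforeP (t : 'I_T.+1) : before_spec t.
Proof.
case: (ltnP t T) => [tT|Tt].
  by have -> : t = before (Ordinal tT) by [apply: val_inj]; constructor.
have -> : t = ord_max; last by constructor.
by apply/val_inj/eqP; rewrite /= eqn_leq Tt -ltnS ltn_ord.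
Qed.

Variant after_spec : 'I_T.+1 -> Type :=
  | After0 : after_spec ord0
  | AfterStep u : after_spec (after u).

Lemma afterP (t : 'I_T.+1) : after_spec t.
Proof.
case: (unliftP ord0 t) => [u ->|->]; last by constructor.
exact: (AfterStep u).
Qed.

Lemma next_node_before i u : next_node (i, before u) = (sg u i, after u).
Proof. by rewrite /next_node /= valK. Qed.

Lemma next_node_max i : next_node (i, ord_max) = (i, ord0).
Proof. by rewrite /next_node insubF //= ltnn. Qed.

Lemma mutated_max i : mutated (i, ord_max) = false.
Proof.
apply/existsP => -[u]; rewrite xpair_eqE eq_sym [_ == before u]eq_sym.
by rewrite (negPf (before_neq_max u)) andbF.
Qed.

Lemma mutated_before i u : mutated (i, before u) = (i == m u).
Proof.
apply/existsP/eqP => [[v]|->]; last by exists u.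
by rewrite xpair_eqE => /andP[/eqP-> /eqP/before_inj->].
Qed.

Lemma glueE p q : glue p q = ~~ mutated p && (q == next_node p).
Proof.
case: p => i t; rewrite /glue /=; case: (beforeP t) => [|u].
  rewrite mutated_max next_node_max /= eqxx /=.
  case: existsP => [[u]|_ /=].
    by rewrite eq_sym (negPf (before_neq_max u)).
  by case: q => j t'; rewrite xpair_eqE /= andbC eq_sym.
rewrite mutated_before next_node_before (negPf (before_neq_max u)) orbF.
apply/existsP/andP => [[v /and3P[/eqP/before_inj<- im]]|[im qE]]; first by [].
by exists u; rewrite eqxx im.
Qed.

Lemma next_node_inj : injective next_node.
Proof.
move=> [i t] [j t']; case: (beforeP t) => [|u]; case: (beforeP t') => [|v];
  rewrite ?next_node_max ?next_node_before => -[].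
- by move=> ->.
- by [].
- by [].
- move=> ij uv; have {}uv : u = v by apply: val_inj.
  by rewrite uv in ij *; move/perm_inj: ij => ->.
Qed.

Lemma node_class_next p :
  ~~ mutated p -> node_class (next_node p) = node_class p.
Proof.
move=> pm; have sym : connect_sym sym_glue.
  by apply: sym_connect_sym => x y /=; rewrite orbC.
apply/setP => q; rewrite !inE; apply: same_connect => //.
by apply: connect1; rewrite /= !glueE pm eqxx orbT.
Qed.

Section FullyMutated.

Hypothesis g_full : fully_mutated g.

(** Full mutation provides a mutated node in the class of [p]. Connected nodes share an orbit of
    [next_node]; orbits are cycles, so that node is also met going forward. *)
Lemma ex_mutated p : exists k, mutated (iter k next_node p).
Proof.
have /g_full[t] : node_class p \in black_vertices g.
  by apply/imsetP; exists p.
rewrite inE => pt.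
have {}pt : fconnect next_node p (mutated_node t).
  apply: connect_sub pt => x y /=; rewrite !glueE.
  case/orP => /andP[_ /eqP->]; first exact: fconnect1.
  by rewrite fconnect_sym ?fconnect1 //; apply: next_node_inj.
exists (findex next_node p (mutated_node t)); rewrite iter_findex //.
by apply/existsP; exists t.
Qed.

Definition mutation_delay p := ex_minn (ex_mutated p).

Definition next_mutated p := iter (mutation_delay p) next_node p.

Lemma mutation_delay0 p : mutated p -> mutation_delay p = 0%N.
Proof.
rewrite /mutation_delay; case: ex_minnP => k _ kmin pm.
by apply/eqP; rewrite -leqn0 kmin.
Qed.

Lemma mutation_delayS p :
  ~~ mutated p -> mutation_delay p = (mutation_delay (next_node p)).+1.
Proof.
rewrite /mutation_delay => pm.
case: ex_minnP => -[|k] km kmin; first by case/negP: pm.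
case: ex_minnP => l lm lmin; apply/eqP.
by rewrite eqn_leq kmin ?iterSr //= ltnS lmin // -iterSr.
Qed.

(** A gluing step shortens the delay by one and keeps the endpoint, so [next_mutated] selects one
    representative per class. *)
Lemma next_mutated_connect p q :
  connect sym_glue p q -> next_mutated p = next_mutated q.
Proof.
have step x y : glue x y -> next_mutated x = next_mutated y.
  rewrite glueE => /andP[xm /eqP->].
  by rewrite /next_mutated mutation_delayS // iterSr.
have /closed_connect cl :
    closed sym_glue [pred x | next_mutated x == next_mutated p].
  move=> x y /=; rewrite !inE => /orP[] /step; first by move->.
  by move<-.
by move/cl; rewrite !inE eqxx => /esym/eqP->.
Qed.

(** Mutated nodes are fixed by [next_mutated], so steps with the same class have the same mutated
    node. *)
Lemma step_class_inj : injective (@step_class n g).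
Proof.
move=> s t st.
have : connect sym_glue (mutated_node s) (mutated_node t).
  have : mutated_node t \in step_class s by rewrite st inE connect0.
  by rewrite inE.
have fix_mut v : next_mutated (mutated_node v) = mutated_node v.
  by rewrite /next_mutated mutation_delay0 //; apply/existsP; exists v.
by move/next_mutated_connect; rewrite !fix_mut => /(congr1 snd)/before_inj.
Qed.

End FullyMutated.

End MutationNetwork.

(** * The two eliminations of the closed linear system *)

Section Determinant.

Variables (n : nat) (g : mutation_sequence n).
Hypothesis g_full : fully_mutated g.

Local Notation T := (ms_len g).
Local Notation m := (tnth (ms_index g)).
Local Notation sg := (tnth (ms_perm g)).
Implicit Types (p q r : node g) (u s t : 'I_T).

Lemma sum_node (V : nmodType) (f : node g -> V) :
  \sum_p f p = \sum_i \sum_t f (i, t).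
Proof. by rewrite pair_bigA; apply: eq_bigr => -[]. Qed.

(** The part of the equation at [p] that gluing does not account for: the coefficient of the unknown
    at [mutated_node t]. *)
Definition update_coef p t : ratfun n :=
  (p.2 == after t)%:R *
  (let i := ((sg t)^-1)%g p.1 in if i == m t then -1 else arrow_weight t i).

Definition class_coef s p : ratfun n := (node_class p == step_class s)%:R.

(** At a node that is not mutated, the class indicator cancels against that of its successor. A
    mutated node is glued to no successor, and [step_class_inj] singles out step [s]. *)
Lemma class_coef_glue s p :
  (p == mutated_node s)%:R
  = class_coef s p - \sum_q class_coef s q * (glue p q)%:R.
Proof.
case: (boolP (mutated p)) => [pm|pm].
  rewrite big1 => [|q _]; last by rewrite glueE pm mulr0.
  case/existsP: pm => t /eqP->; rewrite subr0 /class_coef -/(step_class t).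
  rewrite (inj_eq (step_class_inj g_full)).
  rewrite /mutated_node xpair_eqE (inj_eq (@before_inj _ _)).
  by rewrite andb_idl // => /eqP->.
rewrite (bigD1 (next_node p)) //= glueE pm eqxx mulr1.
rewrite big1 => [|q /negPf qp]; last first.
  by rewrite glueE qp andbF mulr0.
rewrite addr0 /class_coef node_class_next // subrr.
case: eqP => // ps; case/negP: pm; apply/existsP; exists s; exact/eqP.
Qed.

(** Broken edges have total weight [z_minus t + z_plus t = 1]: the one at [before t] gives [s == t],
    the one at [after t] comes from the [-1] in [update_coef]. Arrows give the weights. *)
Lemma tau_class_coef :
  tau g = \det (\matrix_(s, t) ((s == t)%:R
                  - \sum_p class_coef s p * update_coef p t)).
Proof.
rewrite /tau /Z_minus /Z_plus; congr (\det _); apply/matrixP => s t.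
rewrite !mul_mx_diag !mxE.
have -> : \sum_p class_coef s p * update_coef p t
  = - (node_class (sg t (m t), after t) == step_class s)%:R
    + \sum_(i | node_class (i, before t) == step_class s) arrow_weight t i.
  transitivity (\sum_i class_coef s (sg t i, after t)
      * (if i == m t then -1 else arrow_weight t i)).
    rewrite sum_node (reindex_inj (@perm_inj _ (sg t))) /=.
    apply: eq_bigr => i _.
    rewrite (bigD1 (after t)) //= /update_coef /= eqxx permK mul1r.
    by rewrite big1 ?addr0 // => w /negPf->; rewrite mul0r mulr0.
  rewrite (bigD1 (m t)) //= eqxx mulrN1; congr (- _ + _).
  (* The index [m t] drops out on the right because its weight vanishes; the other nodes are glued
     across step [t], so both times give the same class. *)
  rewrite [RHS]big_mkcond [RHS](bigD1 (m t)) //=.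
  rewrite arrow_weight_diag if_same add0r.
  apply: eq_bigr => i /negPf im; rewrite im /class_coef -next_node_before.
  rewrite node_class_next ?mutated_before ?im //.
  by case: ifP; rewrite ?mul1r ?mul0r.
have st : (node_class (m t, before t) == step_class s) = (s == t).
  by rewrite -/(step_class t) (inj_eq (step_class_inj g_full)) eq_sym.
have zE : z_plus t = 1 - z_minus t.
  by rewrite -(z_minusD_plus t) addrC addKr.
rewrite /NZ_plus /NZ_minus /broken_edges st /arrows_to /arrows_from.
rewrite !rmorphB !rmorphD /= !rmorph_sum /=.
have -> : \sum_(i | node_class (i, before t) == step_class s) arrow_weight t i
  = (\sum_(i | node_class (i, before t) == step_class s)
       (pos_part (B_at g t (m t) i))%:~R) * z_minus t
  + (\sum_(i | node_class (i, before t) == step_class s)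
       (pos_part (- B_at g t (m t) i))%:~R) * z_plus t.
  by rewrite !mulr_suml -big_split.
rewrite !rmorph_nat /=.
have weights (R : comNzRingType) (x y a b c : R) :
    (x + y - a) * c + (x + y - b) * (1 - c)
    = x - (- y + (a * c + b * (1 - c))) by ring.
rewrite zE; exact: weights.
Qed.

Definition step_coef p q : ratfun n :=
  \sum_u (p.2 == after u)%:R * (q.2 == before u)%:R * step_mx u p.1 q.1.

(** The logarithmic Jacobians solve the system before it is closed up: the source is the identity at
    time 0, and later equations are the chain rule. *)
Lemma step_coef_log_jacobian p j :
  log_jacobian (Y_at g p.2) p.1 j
  - \sum_q step_coef p q * log_jacobian (Y_at g q.2) q.1 j
  = (p == (j, ord0))%:R.
Proof.
case: p => i t; case: (afterP t) => [|u] /=.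
  rewrite big1 => [|q _]; last first.
    rewrite /step_coef big1 ?mul0r // => u _.
    by rewrite eq_sym (negPf (after_neq0 u)) !mul0r.
  by rewrite subr0 log_jacobian0 mxE xpair_eqE eqxx andbT.
rewrite xpair_eqE (negPf (after_neq0 u)) andbF.
rewrite -[bump 0 u]/(u.+1) log_jacobian_step mxE.
rewrite sum_node -sumrB big1 // => k _; apply/eqP; rewrite subr_eq0; apply/eqP.
have bE w : step_coef (i, after u) (k, w) = (w == before u)%:R * step_mx u i k.
  rewrite /step_coef (bigD1 u) //= eqxx mul1r big1 ?addr0 // => v vu.
  by rewrite (inj_eq (@after_inj _ _)) eq_sym (negPf vu) !mul0r.
rewrite (bigD1 (before u)) //= bE eqxx mul1r big1 ?addr0 // => w /negPf wu.
by rewrite bE wu !mul0r.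
Qed.

(** Two splittings of the closed system: the left side isolates gluing, wraparound included; the
    right side isolates the wraparound from the last time to time 0. *)
Lemma glue_update_step_coef p q :
  (glue q p)%:R + \sum_t update_coef p t * (q == mutated_node t)%:R
  = step_coef p q + \sum_i (q == (i, ord_max))%:R * (p == (i, ord0))%:R.
Proof.
case: p => j t'; case: q => k t; rewrite glueE.
have -> : \sum_i ((k, t) == (i, ord_max))%:R * ((j, t') == (i, ord0))%:R
    = [&& t == ord_max, t' == ord0 & j == k]%:R :> ratfun n.
  rewrite (bigD1 k) //= big1 ?addr0 => [|i /negPf ik]; last first.
    by rewrite xpair_eqE [k == i]eq_sym ik mul0r.
  by rewrite !xpair_eqE eqxx -natrM mulnb /= [(j == k) && _]andbC.
rewrite /step_coef /update_coef /=; case: (afterP t') => [|v].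
  rewrite !big1 => [|u _|u _];
    try by rewrite eq_sym (negPf (after_neq0 u)) !mul0r.
  rewrite eqxx addr0 add0r /=; case: (beforeP t) => [|u].
    by rewrite mutated_max next_node_max xpair_eqE !eqxx andbT.
  rewrite next_node_before xpair_eqE eq_sym [ord0 == _]eq_sym.
  by rewrite (negPf (after_neq0 u)) (negPf (before_neq_max u)) !andbF.
rewrite (negPf (after_neq0 v)) andbF addr0.
rewrite (bigD1 v) //= eqxx mul1r [X in _ + (_ + X)]big1 => [|u uv]; last first.
  by rewrite (inj_eq (@after_inj _ _)) eq_sym (negPf uv) !mul0r.
rewrite [RHS](bigD1 v) //= eqxx mul1r.
rewrite [X in _ = _ + X]big1 => [|u uv]; last first.
  by rewrite (inj_eq (@after_inj _ _)) eq_sym (negPf uv) !mul0r.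
rewrite !addr0 /mutated_node xpair_eqE mxE /=.
case: (beforeP t) => [|u].
  rewrite mutated_max next_node_max xpair_eqE (negPf (after_neq0 v)) !andbF.
  by rewrite [ord_max == _]eq_sym (negPf (before_neq_max v)) andbF
    mulr0 mul0r addr0.
rewrite mutated_before next_node_before xpair_eqE (inj_eq (@after_inj _ _)).
rewrite (inj_eq (@before_inj _ _)) [v == u]eq_sym.
have [->|_] := eqVneq u v; last by rewrite !andbF mulr0 mul0r addr0.
rewrite !andbT mul1r -(can2_eq (permKV (sg v)) (permK (sg v))).
have [->|km] := eqVneq k (m v).
  by rewrite [m v == _]eq_sym; case: eqP => _; rewrite ?mulr1 add0r ?add0r.
rewrite !mulr0 !addr0 oppr0 [k == _]eq_sym.
case: (eqVneq _ k) => [->|_]; last by rewrite if_same.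
by rewrite (negPf km).
Qed.

Lemma tau_log_jacobian :
  tau g = \det (1%:M - log_jacobian (cluster_transformation g)).
Proof.
rewrite tau_class_coef.
(* Elimination along chains: gluing is the graded part, and the perturbation enters through the
   mutated nodes. *)
rewrite -(@det_graded_perturbation _ _ _ (fun p q => (glue q p)%:R) _
  (fun t q => (q == mutated_node t)%:R) _ (mutation_delay g_full)); first last.
- exact: class_coef_glue.
- move=> p q; case: (boolP (glue q p)) => [|_]; last by rewrite eqxx.
  rewrite glueE => /andP[qm /eqP->] _; by rewrite (mutation_delayS g_full qm).
(* [det_graded_perturbation] multiplies by [Q] on the left, whereas the logarithmic Jacobians solve
   the system from the right. *)
rewrite -det_tr tr_fun_mx.
transitivity (\det (fun_mx (fun p q => (p == q)%:R
    - (step_coef q p + \sum_i (p == (i, ord_max))%:R * (q == (i, ord0))%:R)))).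
  congr (\det _); apply/matrixP => a b.
  by rewrite !mxE glue_update_step_coef eq_sym.
(* Elimination along time: the grading is the time of a node, and the perturbation is the
   wraparound. *)
rewrite (@det_graded_perturbation _ _ _ (fun p q => step_coef q p)
  (fun p i => (p == (i, ord_max))%:R) (fun i q => (q == (i, ord0))%:R)
  (fun i p => log_jacobian (Y_at g p.2) p.1 i) (fun p => p.2)); first last.
- move=> i q; rewrite -step_coef_log_jacobian.
  by under eq_bigr do rewrite mulrC.
- move=> p q; apply: contraR => pq; rewrite /step_coef big1 // => u _.
  case: eqP => [qu|_]; last by rewrite !mul0r.
  case: eqP => [pu|_]; last by rewrite mulr0 mul0r.
  by case/negP: pq; rewrite qu pu /= ltnSn.
(* The sum over nodes retains only time [ord_max], where the logarithmic Jacobian is that of the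
   cluster transformation. *)
rewrite -det_tr; congr (\det _); apply/matrixP => i j; rewrite !mxE eq_sym.
congr (_ - _); rewrite (bigD1 (i, ord_max)) //= eqxx mulr1 big1 ?addr0 ?mxE //.
by move=> p /negPf->; rewrite mulr0.
Qed.

End Determinant.

Theorem corollary1p2 (n : nat) (n_gt0 : (0 < n)%N)
    (g g' : mutation_sequence n)
    (g_full : fully_mutated g) (g'_full : fully_mutated g') :
  cluster_transformation g = cluster_transformation g' -> tau g = tau g'.
Proof. by move=> gg'; rewrite !tau_log_jacobian // gg'. Qed.
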